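(* Let $k\le n$ and $s$ be positive integers and let $\lambda$ be a partition of $k$ with at most $s$ parts. Then $\dim_{\mathbb{Q}}(R_{n,\lambda,s})=|\mathcal{OP}_{n,\lambda,s}|$. Furthermore, there is an isomorphism of $S_n$-modules $R_{n,\lambda,s}\cong\mathbb{Q}\,\mathcal{OP}_{n,\lambda,s}$.
   Context: A partition $\lambda=(\lambda_1\ge\dots\ge\lambda_{\ell(\lambda)}>0)$ has length $\ell(\lambda)$; set $\lambda_i=0$ for $i>\ell(\lambda)$, and let $\lambda'_j=\#\{i:\lambda_i\ge j\}$ be the parts of the conjugate partition (with $\lambda'_j=0$ for large $j$). Let $\mathbf{x}_n=\{x_1,\dots,x_n\}$; $S_n$ acts on $\mathbb{Q}[\mathbf{x}_n]$ by permuting variables. For $S\subseteq\mathbf{x}_n$ and $d\ge1$, $e_d(S)$ is the sum of all squarefree monomials of degree $d$ in the variables in $S$ (so $e_d(S)=0$ if $d>|S|$). For $0\le m\le n$ let $p^n_m(\lambda)=\lambda'_n+\lambda'_{n-1}+\dots+\lambda'_{n-m+1}$. Define $$I_{n,\lambda,s}=\langle x_i^s : 1\le i\le n\rangle+\langle e_d(S): S\subseteq\mathbf{x}_n,\ d>|S|-p^n_{|S|}(\lambda)\rangle,\qquad R_{n,\lambda,s}=\mathbb{Q}[\mathbf{x}_n]/I_{n,\lambda,s}.$$ $\mathcal{OP}_{n,\lambda,s}$ is the set of $(n,\lambda,s)$-ordered set partitions: ordered tuples $(B_1|\cdots|B_s)$ of pairwise disjoint (possibly empty) subsets of $[n]=\{1,\dots,n\}$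 with union $[n]$ and $|B_i|\ge\lambda_i$ for all $1\le i\le s$. $S_n$ acts on $\mathcal{OP}_{n,\lambda,s}$ by permuting the letters $1,\dots,n$, and $\mathbb{Q}\,\mathcal{OP}_{n,\lambda,s}$ is the corresponding permutation module. *)

(* Defs.v *)
From HB Require Import structures.
From mathcomp Require Import all_boot all_order all_fingroup all_algebra.
From mathcomp Require Import mpoly.
From mathcomp.classical Require Import boolp.

Set Implicit Arguments.
Unset Strict Implicit.
Unset Printing Implicit Defensive.

Import GRing.Theory.
Import Quotient.Exports.

Local Open Scope ring_scope.
Local Open Scope quotient_scope.

Section GeneratedIdeal.
Variable A : comNzRingType.

(* Finite sums of A-multiples of elements of G. *)
Definition in_gen_ideal (G : A -> Prop) (p : A) : Prop :=
  exists (m : nat) (c g : 'I_m -> A),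
    (forall i, G (g i)) /\ p = \sum_(i < m) c i * g i.

Definition gen_ideal (G : A -> Prop) : {pred A} :=
  fun p => `[< in_gen_ideal G p >].

Variable G : A -> Prop.

Lemma gen_idealP p : reflect (in_gen_ideal G p) (p \in gen_ideal G).
Proof. exact: asboolP. Qed.

Lemma gen_idealM a p : p \in gen_ideal G -> a * p \in gen_ideal G.
Proof.
move=> /gen_idealP[m [c [g [Gg ->]]]]; apply/gen_idealP.
exists m, (fun i => a * c i), g; split=> //.
by rewrite mulr_sumr; apply: eq_bigr => i _; rewrite mulrA.
Qed.

Lemma gen_ideal_zmod_closed : zmod_closed (gen_ideal G).
Proof.
have addI p q : p \in gen_ideal G -> q \in gen_ideal G ->
    p + q \in gen_ideal G.
  move=> /gen_idealP[m [c [g [Gg ->]]]] /gen_idealP[m' [c' [g' [Gg' ->]]]].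
  apply/gen_idealP; exists (m + m')%N.
  exists (fun i => match split i with inl j => c j | inr j => c' j end).
  exists (fun i => match split i with inl j => g j | inr j => g' j end).
  split=> [i|]; first by case: (split i).
  rewrite big_split_ord /=; congr (_ + _); apply: eq_bigr => i _.
    by rewrite -/(unsplit (inl i)) unsplitK.
  by rewrite -/(unsplit (inr i)) unsplitK.
split=> [|p q Ip Iq].
  by apply/gen_idealP; exists 0%N, (fun _ => 0), (fun _ => 0);
    split=> [[]|]//; rewrite big_ord0.
by apply: addI => //; rewrite -mulN1r; apply: gen_idealM.
Qed.

HB.instance Definition _ :=
  GRing.isZmodClosed.Build A (gen_ideal G) gen_ideal_zmod_closed.

End GeneratedIdeal.

(* The quotient of an algebra by the ideal generated by G, as a vector space.
   [{ideal_quot _}] is not used, as it requires a proof that 1 is not in the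
   ideal. *)
Section QuotientModule.
Variables (K : fieldType) (A : comAlgType K) (G : A -> Prop).

Definition quot_mod := Quotient.quot (gen_ideal G).
HB.instance Definition _ := GRing.Zmodule.on quot_mod.
HB.instance Definition _ := EqQuotient.on quot_mod.

Definition quot_proj (p : A) : quot_mod := \pi p.

Lemma quot_projP p q :
  reflect (quot_proj p = quot_proj q) (p - q \in gen_ideal G).
Proof. by rewrite Quotient.idealrBE; apply: eqP. Qed.

Lemma quot_projK (x : quot_mod) : quot_proj (generic_quotient.repr x) = x.
Proof. exact: reprK. Qed.

Lemma quot_projD p q : quot_proj (p + q) = quot_proj p + quot_proj q.
Proof. exact: Quotient.pi_add. Qed.

Definition quot_scale (a : K) (x : quot_mod) : quot_mod :=
  quot_proj (a *: generic_quotient.repr x).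

Lemma quot_projZ a p : quot_proj (a *: p) = quot_scale a (quot_proj p).
Proof.
apply/quot_projP; rewrite -scalerBr -mulr_algl; apply: gen_idealM.
by apply/quot_projP; rewrite quot_projK.
Qed.

Fact quot_scaleA a b v :
  quot_scale a (quot_scale b v) = quot_scale (a * b) v.
Proof. by rewrite -(quot_projK v) -!quot_projZ scalerA. Qed.

Fact quot_scale1 : left_id 1 quot_scale.
Proof. by move=> v; rewrite -(quot_projK v) -quot_projZ scale1r. Qed.

Fact quot_scaleDr : right_distributive quot_scale +%R.
Proof.
move=> a u v; rewrite -(quot_projK u) -(quot_projK v).
by rewrite -quot_projD -!quot_projZ -quot_projD scalerDr.
Qed.

Fact quot_scaleDl v : {morph quot_scale^~ v : a b / a + b}.
Proof.
by move=> a b; rewrite -(quot_projK v) -!quot_projZ -quot_projD scalerDl.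
Qed.

HB.instance Definition _ := GRing.Zmodule_isLmodule.Build K quot_mod
  quot_scaleA quot_scale1 quot_scaleDr quot_scaleDl.

End QuotientModule.

Section Dimension.
Variables (K : fieldType) (V : lmodType K).

Definition is_basis (d : nat) (b : 'I_d -> V) : Prop :=
  (forall c : 'I_d -> K, \sum_(i < d) c i *: b i = 0 -> forall i, c i = 0) /\
  (forall v : V, exists c : 'I_d -> K, v = \sum_(i < d) c i *: b i).

Definition has_dim (d : nat) : Prop := exists b : 'I_d -> V, is_basis b.

End Dimension.

Definition is_partition (k : nat) (la : seq nat) : bool :=
  [&& sorted geq la, 0%N \notin la & sumn la == k].

(* [conj_part la j] is the j-th part of the conjugate partition, for j >= 1. *)
Definition conj_part (la : seq nat) (j : nat) : nat :=
  count (fun part => j <= part)%N la.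

(* Only meaningful for m <= n. *)
Definition p_stat (n : nat) (la : seq nat) (m : nat) : nat :=
  (\sum_(i < m) conj_part la (n - i))%N.

Definition esym_on (n : nat) (S : {set 'I_n}) (d : nat) : {mpoly rat[n]} :=
  \sum_(T : {set 'I_n} | (T \subset S) && (#|T| == d)) \prod_(i in T) 'X_i.

(* The condition d > |S| - p is written |S| < d + p, as natural number
   subtraction is truncated. *)
Inductive I_gen (n : nat) (la : seq nat) (s : nat) : {mpoly rat[n]} -> Prop :=
| I_gen_pow (i : 'I_n) : I_gen la s ('X_i ^+ s)
| I_gen_esym (S : {set 'I_n}) (d : nat) :
    (1 <= d)%N -> (#|S| < d + p_stat n la #|S|)%N -> I_gen la s (esym_on S d).

Definition R_quot (n : nat) (la : seq nat) (s : nat) : lmodType rat :=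
  quot_mod (@I_gen n la s).

Section ActionOnR.
Variables (n : nat) (la : seq nat) (s : nat).
Implicit Types (w : 'S_n) (p : {mpoly rat[n]}).

(* [msym w] substitutes 'X_(w i) for 'X_i. *)
Definition R_act (w : 'S_n) (x : R_quot n la s) : R_quot n la s :=
  quot_proj _ (msym w (generic_quotient.repr (x : quot_mod (@I_gen n la s)))).

Lemma msymXU w (i : 'I_n) : msym w 'X_i = 'X_(w i) :> {mpoly rat[n]}.
Proof. by rewrite /msym mmapX mmap1U. Qed.

Lemma msym_esym_on w (S : {set 'I_n}) d :
  msym w (esym_on S d) = esym_on (w @: S) d.
Proof.
rewrite /esym_on raddf_sum /=.
rewrite [RHS](reindex_inj (imset_inj (@perm_inj _ w))) /=.
apply: eq_big => [T|T _].
  rewrite (card_imset _ (@perm_inj _ w)); congr (_ && _).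
  apply/idP/idP => [|/subsetP sTS]; first exact: imsetS.
  apply/subsetP => i Ti.
  by have := sTS _ (imset_f w Ti); rewrite mem_imset //; apply: perm_inj.
rewrite rmorph_prod /= big_imset /=; last by move=> i j _ _; apply: perm_inj.
by apply: eq_bigr => i _; rewrite msymXU.
Qed.

Lemma msym_I_gen w p : I_gen la s p -> I_gen la s (msym w p).
Proof.
case=> [i|S d d_gt0 ltSd]; first by rewrite rmorphXn /= msymXU; left.
rewrite msym_esym_on; right=> //.
by rewrite (card_imset _ (@perm_inj _ w)).
Qed.

Lemma msym_ideal w p :
  p \in gen_ideal (@I_gen n la s) -> msym w p \in gen_ideal (@I_gen n la s).
Proof.
move=> /gen_idealP[m [c [g [Gg ->]]]]; apply/gen_idealP.
exists m, (msym w \o c), (msym w \o g); split=> [i|/=].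
  exact: msym_I_gen.
by rewrite raddf_sum; apply: eq_bigr => i _; exact: rmorphM.
Qed.

Lemma R_act_proj w p :
  R_act w (quot_proj _ p) = quot_proj _ (msym w p).
Proof.
apply/quot_projP; rewrite -raddfB; apply: msym_ideal.
by apply/quot_projP; rewrite quot_projK.
Qed.

(* Products of permutations are read from left to right in MathComp. *)
Lemma R_actM w1 w2 x : R_act (w1 * w2) x = R_act w2 (R_act w1 x).
Proof. by rewrite -(quot_projK x) !R_act_proj msymMm. Qed.

Lemma R_act1 x : R_act 1 x = x.
Proof. by rewrite -(quot_projK x) R_act_proj msym1m. Qed.

Lemma R_act_linear w : linear (R_act w).
Proof.
move=> a x y; rewrite -(quot_projK x) -(quot_projK y).
rewrite -[a *: _]quot_projZ -[LHS]/(R_act w (_ + _)).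
rewrite -quot_projD !R_act_proj -[a *: _]quot_projZ.
by rewrite -[RHS]quot_projD msymD msymZ.
Qed.

End ActionOnR.

Section OrderedSetPartitions.
Variables (n : nat) (la : seq nat) (s : nat).

(* Blocks are indexed from 0, as are the parts of la. *)
Definition is_osp (B : {ffun 'I_s -> {set 'I_n}}) : bool :=
  [&& [forall i, forall j, (i != j) ==> [disjoint B i & B j]],
      \bigcup_(i < s) B i == [set: 'I_n]
    & [forall i : 'I_s, (nth 0 la i <= #|B i|)%N]].

Definition OP : finType := {B : {ffun 'I_s -> {set 'I_n}} | is_osp B}.

Definition osp_move (w : 'S_n) (B : {ffun 'I_s -> {set 'I_n}}) :
  {ffun 'I_s -> {set 'I_n}} := [ffun i => w @: B i].

Lemma osp_move_subproof (w : 'S_n) (B : OP) : is_osp (osp_move w (val B)).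
Proof.
case: B => B /= /and3P[/'forall_'forall_implyP disB /eqP covB /forallP leB].
apply/and3P; split.
- apply/'forall_'forall_implyP => i j neq_ij; rewrite !ffunE.
  by rewrite (imset_disjoint (@perm_inj _ w)) disB.
- apply/eqP/setP => x; rewrite !inE; apply/bigcupP.
  have : (w^-1)%g x \in \bigcup_(i < s) B i by rewrite covB inE.
  case/bigcupP => i _ Bx; exists i => //; rewrite ffunE.
  by apply/imsetP; exists ((w^-1)%g x) => //; rewrite permKV.
- by apply/forallP => i; rewrite ffunE (card_imset _ (@perm_inj _ w)).
Qed.

Definition OP_act (w : 'S_n) (B : OP) : OP := Sub _ (osp_move_subproof w B).

Lemma OP_act1 B : OP_act 1 B = B.
Proof.
apply/val_inj/ffunP => i; rewrite SubK ffunE.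
by rewrite (eq_imset _ (fun x => perm1 x)) imset_id.
Qed.

Lemma OP_actM w1 w2 B : OP_act (w1 * w2) B = OP_act w2 (OP_act w1 B).
Proof.
apply/val_inj/ffunP => i; rewrite !SubK !ffunE.
by rewrite (eq_imset _ (fun x => permM w1 w2 x)) (imset_comp w2 w1).
Qed.

(* The vector space with basis OP: f is the formal sum of the f B * B. *)
Definition QOP : lmodType rat := {ffun OP -> rat^o}.

(* The linear extension of [OP_act w], see [QOP_act_basis]. *)
Definition QOP_act (w : 'S_n) (f : QOP) : QOP :=
  [ffun B : OP => (f : {ffun OP -> rat^o}) (OP_act w^-1 B)].

Definition QOP_basis (B : OP) : QOP := [ffun C : OP => (C == B)%:R : rat^o].

Lemma QOP_act_basis w B : QOP_act w (QOP_basis B) = QOP_basis (OP_act w B).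
Proof.
apply/ffunP => C; rewrite !ffunE; congr (_%:R).
by congr nat_of_bool; apply/eqP/eqP => [<-|->]; rewrite -OP_actM;
  rewrite ?mulVg ?mulgV OP_act1.
Qed.

Lemma QOP_act_linear w : linear (QOP_act w).
Proof. by move=> a f g; apply/ffunP => B; rewrite !ffunE. Qed.

End OrderedSetPartitions.

(* Main.v *)
Require Import Defs.
From HB Require Import structures.
From mathcomp Require Import all_boot all_order all_fingroup all_algebra.
From mathcomp Require Import mpoly zify ring.
Set Implicit Arguments.
Unset Strict Implicit.
Unset Printing Implicit Defensive.
Import GRing.Theory Num.Theory.
Local Open Scope ring_scope.

(** Let [I] be the defining ideal. To an ordered set partition [B] one attaches the
    point of [Q^n] whose [i]-th coordinate is the index of the block containing
    [i]. Restriction of polynomials to these points is an equivariant surjection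
    [ev] onto [QOP], and the theorem says that the quotient by [I] is the graded
    version of [QOP] for the filtration by degree.

    Lower bound. Every generator of [I] is the top form of a polynomial that
    vanishes on the points. For [X_i ^+ s] this polynomial is the product of the
    [X_i - b] over the [s] block indices [b] ([pow_lower]). For [e_d(S)] one uses
    that at the point of [B] the product of the [1 - x_i T], for [i] in [S], is
    divisible by [G], the product over [b] of the powers of [1 - b T] with exponents
    [max (la_b - (n - #|S|)) 0]; the sum of these exponents is the statistic
    [p_stat], so the coefficients of degree [d > #|S| - p_stat] of the quotient by
    [G] vanish ([esym_relation], [esym_lower]). Averaging over the symmetric group
    gives an equivariant projection onto the space [lowspace d] of restrictions of
    polynomials of degree less than [d]. Sending a form of degree [d] to its
    restriction, minus the projection of the latter to [lowspace d], gives an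
    equivariant linear map [top_ev] from polynomials to [QOP]. It kills [I]
    ([top_ev_mul_lower]) and it is surjective ([top_ev_surj]).

    Upper bound. The quotient by [I] is spanned by at most [#|OP|] elements
    ([R_quot_span]). Filter it by the powers of one variable [X_a], and order the
    parts of [la] decreasingly. The layer of [X_a ^+ i] is a cyclic module over the
    polynomials in the other variables, and it is killed by the ideal attached to
    [la] with the [i]-th part, counted from 0, decreased by one ([gens_in_layer]).
    This mirrors the recursion for ordered set partitions obtained from the block
    that contains [a]; there are [s] layers because [X_a ^+ s] is in [I]. The
    induction is carried out for a vector [v] and a subspace [W] such that the
    generators map [v] into [W] ([span_cyc]), since the layers are cyclic modules
    and not rings.

    A surjection from a space spanned by [#|OP|] elements onto one of dimension
    [#|OP|] is bijective, which gives both claims. *)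

(** * Elementary symmetric polynomials in a subset of the variables *)
Section EsymOn.
Variable n : nat.
Implicit Types (S : {set 'I_n}) (d : nat) (a : 'I_n).

Lemma esym_on_0 S : esym_on S 0 = 1.
Proof.
rewrite /esym_on (big_pred1 set0) ?big_set0 // => T /=.
by rewrite cards_eq0 andb_idl // => /eqP->; rewrite sub0set.
Qed.

Lemma esym_on_set0 d : esym_on (set0 : {set 'I_n}) d.+1 = 0.
Proof.
rewrite /esym_on big_pred0 // => T; rewrite subset0.
by case: eqP => // ->; rewrite cards0.
Qed.

Lemma esym_on_setU1 a S d : a \notin S ->
  esym_on (a |: S) d.+1 = esym_on S d.+1 + 'X_a * esym_on S d.
Proof.
move=> aS; rewrite /esym_on (bigID (fun T : {set 'I_n} => a \in T)) /= addrC.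
congr (_ + _).
  apply: eq_bigl => T; case: (boolP (a \in T)) => aT /=.
    rewrite andbF; symmetry; apply/negbTE; apply: contra aS => /andP[sTS _].
    exact: (subsetP sTS).
  by rewrite andbT -[in RHS](setU1K aS) subsetD1 aT andbT.
rewrite mulr_sumr.
rewrite (reindex_onto (fun U => a |: U) (fun T => T :\ a)) /=; last first.
  by move=> T /andP[_ aT]; rewrite setD1K.
apply: eq_big => [U|U]; last first.
  case/andP=> /andP[_ aU] /eqP aUK; rewrite big_setU1 //=.
  by rewrite -aUK !inE eqxx.
rewrite setU11 andbT.
case: (boolP (a \in U)) => aU.
  have -> : (U \subset S) = false.
    by apply/negbTE; apply: contra aS => /subsetP; apply.
  rewrite /=; apply/negbTE; rewrite negb_and; apply/orP; right.
  by apply/eqP => /setP/(_ a); rewrite !inE eqxx aU.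
rewrite setU1K // eqxx andbT cardsU1 aU eqSS; congr (_ && _).
rewrite subUset sub1set setU11 /=.
apply/idP/idP => [/subsetP sU | /subset_trans-> //]; last exact: subsetUr.
apply/subsetP=> x xU; have := sU _ xU; rewrite !inE => /orP[/eqP xa|//].
by rewrite -xa xU in aU.
Qed.

End EsymOn.

(** * Spanning modulo a subspace *)
Section SpanMod.
Variables (K : fieldType) (V : lmodType K).
Implicit Types (W U : V -> Prop) (v y : V) (L : seq V).

(** [W] is a linear subspace of [V], which may have infinite dimension. *)
Definition subsp W : Prop :=
  W 0 /\ forall c x y, W x -> W y -> W (c *: x + y).

Lemma subspD W x y : subsp W -> W x -> W y -> W (x + y).
Proof. by case=> _ /(_ 1 x y); rewrite scale1r. Qed.

Lemma subspZ W c x : subsp W -> W x -> W (c *: x).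
Proof. by case=> W0 /(_ c x 0); rewrite addr0 => + Wx; apply. Qed.

Lemma subspB W x y : subsp W -> W x -> W y -> W (x - y).
Proof. by case=> _ /(_ (-1) y x); rewrite scaleN1r addrC => + Wx Wy; apply. Qed.

(** The sum of [W] and of the line spanned by [v]. *)
Definition add_line v W : V -> Prop := fun y => exists c, W (y - c *: v).

(** The sum of [W] and of the span of the vectors in the list [L]. *)
Definition span_mod W L : V -> Prop := foldr add_line W L.

Lemma span_mod_mono W U L y :
  (forall x, W x -> U x) -> span_mod W L y -> span_mod U L y.
Proof.
move=> WU; elim: L y => [|v L IHL] y /=; first exact: WU.
by case=> c /IHL; exists c.
Qed.

Lemma span_mod_cat W L1 L2 y :
  span_mod (span_mod W L2) L1 y -> span_mod W (L1 ++ L2) y.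
Proof. by rewrite /span_mod foldr_cat. Qed.

Lemma span_mod_subsp W L : subsp W -> subsp (span_mod W L).
Proof.
move=> sW; elim: L => //= v L [IH0 IHD]; split.
  by exists 0; rewrite scale0r subr0.
move=> c x y [a Lx] [b Ly]; exists (c * a + b).
rewrite scalerDl -scalerA opprD addrACA -scalerBr; exact: IHD.
Qed.

Lemma span_mod_sub W L y : subsp W -> W y -> span_mod W L y.
Proof.
move=> sW Wy; elim: L => //= v L IH.
by exists 0; rewrite scale0r subr0.
Qed.

Lemma span_mod_sum W L y : span_mod W L y ->
  exists c : 'I_(size L) -> K, W (y - \sum_(i < size L) c i *: L`_i).
Proof.
elim: L y => [|v L IHL] y /=.
  by exists (fun=> 0); rewrite big_ord0 subr0.
case=> a /IHL[c Wc]; exists (fun i => if unlift ord0 i is Some j then c j else a).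
rewrite big_ord_recl unlift_none /= opprD addrA.
by under eq_bigr => i _ do rewrite liftK.
Qed.

End SpanMod.

(** * The upper bound: a recursion on the number of variables *)
Section UpperBound.
Variables (n s : nat).
Notation P := {mpoly rat[n]}.
Implicit Types (D S : {set 'I_n}) (W : P -> Prop) (v y : P).
Implicit Types (lam : 'I_s -> nat) (a : 'I_n) (b : 'I_s).

(** [W] is stable under multiplication by the variables indexed by [D]. *)
Definition mul_closed D W : Prop := forall i y, i \in D -> W y -> W ('X_i * y).

(** The cyclic submodule generated by [v] over the polynomial ring in the
    variables indexed by [D]: the least subspace that contains [v] and is stable
    under multiplication by these variables. *)
Inductive cyc D v : P -> Prop :=
| cyc_gen : cyc D v v
| cyc_0 : cyc D v 0
| cyc_lin c x y : cyc D v x -> cyc D v y -> cyc D v (c *: x + y)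
| cyc_X i y : i \in D -> cyc D v y -> cyc D v ('X_i * y).

Lemma cyc_subsp D v : subsp (cyc D v).
Proof. by split; [exact: cyc_0|move=> *; exact: cyc_lin]. Qed.

Lemma cyc_min D v W y :
  subsp W -> mul_closed D W -> W v -> cyc D v y -> W y.
Proof.
move=> [W0 WD] WM Wv; elim=> // [c x z _ Wx _ Wz|i z iD _ Wz].
  exact: WD.
exact: WM.
Qed.

Lemma cyc_mulX D v a y : cyc D v y -> cyc D ('X_a * v) ('X_a * y).
Proof.
elim=> [||c x z _ Wx _ Wz|i z iD _ Wz].
- exact: cyc_gen.
- by rewrite mulr0; exact: cyc_0.
- by rewrite mulrDr -scalerAr; exact: cyc_lin.
- by rewrite mulrCA; exact: cyc_X.
Qed.

(** Separating the part of a polynomial that is divisible by [X_a]: if [Q] is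
    the polynomial ring in the variables of [D] other than [X_a], then
    [Q[X_a] v = Q v + X_a Q[X_a] v]. *)
Lemma cyc_split D v a y : a \in D -> cyc D v y ->
  exists y0 y1, [/\ cyc (D :\ a) v y0, cyc D ('X_a * v) y1 & y = y0 + y1].
Proof.
move=> aD; elim=> [||c x z _ [x0 [x1 [x0P x1P ->]]] _ [z0 [z1 [z0P z1P ->]]]|].
- by exists v, 0; rewrite addr0; split=> //; [exact: cyc_gen|exact: cyc_0].
- by exists 0, 0; rewrite addr0; split=> //; exact: cyc_0.
- exists (c *: x0 + z0), (c *: x1 + z1); rewrite scalerDr addrACA.
  by split=> //; exact: cyc_lin.
- move=> i z iD zP [z0 [z1 [z0P z1P z_def]]].
  have [ia|ia] := eqVneq i a; last first.
    exists ('X_i * z0), ('X_i * z1); rewrite z_def mulrDr; split=> //.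
      by apply: cyc_X => //; rewrite !inE ia.
    exact: cyc_X.
  exists 0, ('X_i * z); rewrite add0r; split=> //; first exact: cyc_0.
  by rewrite ia; apply: cyc_mulX.
Qed.

Lemma cyc_esym D v S d y :
  S \subset D -> cyc D v y -> cyc D v (esym_on S d * y).
Proof.
move=> /subsetP sSD yP; rewrite mulr_suml.
elim/big_ind: _ => [|p q|T /andP[/subsetP sTS _]]; first exact: cyc_0.
- by move=> pP qP; exact: subspD (cyc_subsp _ _) pP qP.
- elim/big_rec: _ => [|i p iT IH]; first by rewrite mul1r.
  by rewrite -mulrA; apply: cyc_X => //; apply/sSD/sTS.
Qed.

(** The number of boxes of [lam] beyond the first [c] ones in each row, that is,
    the sum of the [max (lam b - c) 0]. The rows of [lam] need not be sorted. For
    a partition of [k <= n] the statistic [p_stat n la m] is the excess beyond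
    [n - m]; unlike [p_stat], the excess is the right notion also for compositions
    whose size exceeds the number of variables, which occur in the recursion. *)
Definition excess lam (c : nat) : nat := \sum_(b < s) (lam b - c).

(** [lam] with row [b] decreased by one, an empty row being left empty. *)
Definition dec_at lam b : 'I_s -> nat := fun j => (lam j - (j == b))%N.

(** The number of words of length [m] over the alphabet ['I_s] in which every
    letter [b] occurs at least [lam b] times, defined by recursion on the first
    letter; see [card_words]. *)
Fixpoint nb_words (m : nat) lam : nat :=
  if m is m'.+1 then \sum_(b < s) nb_words m' (dec_at lam b)
  else [forall b, lam b == 0%N].

Lemma excess_dec_at lam b c :
  excess (dec_at lam b) c = (excess lam c - (c < lam b))%N.
Proof.
rewrite /excess (bigD1 b) //= [in RHS](bigD1 b) //= /dec_at eqxx.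
rewrite (eq_bigr (fun j => lam j - c)%N) => [|j /negbTE->]; last by rewrite subn0.
by lia.
Qed.

Lemma excessS lam c :
  excess lam c = (excess lam c.+1 + \sum_(b < s) (c < lam b))%N.
Proof. by rewrite /excess -big_split /=; apply: eq_bigr => b _; lia. Qed.

(** The generators of the ideal attached to the variables of [D] and to the
    composition [lam] map [v] into [W]. The degree [d] may be 0, and then
    [esym_on S d = 1]: when [lam] has more than [#|D|] boxes, the condition is
    met by [d = 0] and the full set [D], and it forces [v] itself into [W]. *)
Definition gens_in D lam v W : Prop :=
  (forall i, i \in D -> W ('X_i ^+ s * v)) /\
  (forall S d, S \subset D ->
     (#|S| < d + excess lam (#|D| - #|S|))%N -> W (esym_on S d * v)).

(** Since [e_(d+1)(S + a) = e_(d+1)(S) + X_a e_d(S)], one factor [X_a] may be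
    traded, up to sign and modulo [W], for one more degree of [e_d(S)]. *)
Lemma esym_on_trade D a S d j v W : subsp W -> mul_closed D W ->
    a \in D -> a \notin S ->
    (forall d', (d < d')%N -> W (esym_on (a |: S) d' * v)) ->
    W (esym_on S (d + j) * v) ->
  W (esym_on S d * ('X_a ^+ j * v)).
Proof.
move=> sW WM aD aS; elim: j d => [|j IHj] d Wa Wj.
  by rewrite addn0 in Wj; rewrite expr0 mul1r.
have -> : esym_on S d * ('X_a ^+ j.+1 * v) =
    'X_a ^+ j * (esym_on (a |: S) d.+1 * v) - esym_on S d.+1 * ('X_a ^+ j * v).
  by rewrite esym_on_setU1 // exprS; ring.
apply: subspB => //; last first.
  by apply: IHj => [d' d'd|]; [apply: Wa; apply: ltnW|rewrite addSnnS].
elim: j {IHj Wj} => [|j IHj]; first by rewrite expr0 mul1r; exact: Wa.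
by rewrite exprS -mulrA; exact: WM.
Qed.

(** The step of the recursion. The cyclic module of [v] is filtered by the powers
    of [X_a], and its [i]-th layer, modulo the next one, is a cyclic module over
    one variable less that is killed by the generators for [dec_at lam b].
    Here [b] is a row of [lam] such that at most [i] rows are longer than [c]
    whenever [c] is at least the length of row [b]: this holds when [b] comes
    in position [i], counted from 0, in an ordering of the rows by decreasing
    length. *)
Lemma gens_in_layer D lam v W a i b : subsp W -> mul_closed D W ->
    gens_in D lam v W -> a \in D ->
    (forall c, (lam b <= c)%N -> (\sum_(b' < s) (c < lam b')%N <= i)%N) ->
  gens_in (D :\ a) (dec_at lam b) ('X_a ^+ i * v)
    (fun y => exists w z, [/\ W w, cyc D ('X_a ^+ i.+1 * v) z & y = w + z]).
Proof.
move=> sW WM [Wpow Wesym] aD Hb.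
have WXi y : W y -> W ('X_a ^+ i * y).
  move=> Wy; elim: i {Hb} => [|i IH]; first by rewrite expr0 mul1r.
  by rewrite exprS -mulrA; exact: WM.
have inW y : W y -> exists w z, [/\ W w, cyc D ('X_a ^+ i.+1 * v) z & y = w + z].
  by exists y, 0; rewrite addr0; split=> //; exact: cyc_0.
split=> [j /setD1P[_ jD]|S d sSD ltSd].
  by apply: inW; rewrite mulrCA; apply/WXi/Wpow.
have aS : a \notin S by apply/negP => /(subsetP sSD); rewrite !inE eqxx.
have sSaD : a |: S \subset D.
  by rewrite subUset sub1set aD (subset_trans sSD) // subsetDl.
have cD : #|D| = #|D :\ a|.+1 by rewrite (cardsD1 a) aD.
have cS : (#|S| <= #|D :\ a|)%N by exact: subset_leq_card.
have cSa : #|a |: S| = #|S|.+1 by rewrite cardsU1 aS.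
set c := (#|D :\ a| - #|S|)%N in ltSd.
have ec1 : (#|D| - #|a |: S|)%N = c by rewrite cD cSa subSS.
have ec2 : (#|D| - #|S|)%N = c.+1 by rewrite cD subSn.
have [lbc|lbc] := ltnP c (lam b).
  (* The box removed from row b is counted in the excess beyond c: e_d(a + S) is
     a generator for lam, so e_d(S) agrees with - X_a e_(d-1)(S) modulo W. *)
  have Wd : W (esym_on (a |: S) d * v).
    apply: Wesym => //; rewrite ec1 cSa.
    have : (lam b - c <= excess lam c)%N by rewrite /excess (bigD1 b) //= leq_addr.
    by move: ltSd; rewrite excess_dec_at lbc; lia.
  case: d {ltSd} Wd => [|d] Wd.
    rewrite esym_on_0 mul1r; apply: inW; apply: WXi.
    by rewrite esym_on_0 mul1r in Wd.
  exists ('X_a ^+ i * (esym_on (a |: S) d.+1 * v)).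
  exists (- (esym_on S d * ('X_a ^+ i.+1 * v))); split; first exact: WXi.
    rewrite -scaleN1r; apply: subspZ; first exact: cyc_subsp.
    apply: cyc_esym; last exact: cyc_gen.
    by apply: subset_trans sSD _; exact: subsetDl.
  by rewrite esym_on_setU1 // exprS; ring.
(* The excess beyond c is unchanged: e_d'(a + S) is a generator for lam whenever
   d' > d, and so is e_(d+i)(S), as at most i rows are longer than c. *)
apply: inW; apply: (esym_on_trade sW WM) => // [d' d'd|].
  apply: Wesym => //; rewrite ec1 cSa.
  by move: ltSd; rewrite excess_dec_at; lia.
apply: Wesym; first by apply: subset_trans sSaD; exact: subsetUr.
rewrite ec2; have := Hb _ lbc; have := excessS lam c.
by move: ltSd; rewrite excess_dec_at; lia.
Qed.

(** The upper bound on dimensions, in relative form: modulo [W], the cyclic module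
    of [v] is spanned by as many elements as there are words counted by
    [nb_words]. The ideal [W] and the vector [v = 1] give the quotient ring. *)
Lemma span_cyc D lam v W : subsp W -> mul_closed D W -> gens_in D lam v W ->
  exists L : seq P, size L = nb_words #|D| lam /\
    forall y, cyc D v y -> span_mod W L y.
Proof.
have [m] := ubnP #|D|; elim: m => // m IHm in D lam v W * => ltDm sW WM gW.
have [D0|[a aD]] := set_0Vmem D.
  subst D; rewrite cards0 /=; have [la0|] := boolP [forall b, lam b == 0%N].
    exists [:: v]; split=> // y; elim=> [||c x z _ [a Wx] _ [b Wz]|i z].
    - by exists 1; rewrite scale1r subrr; case: sW.
    - by exists 0; rewrite scale0r subr0; case: sW.
    - exists (c * a + b); rewrite scalerDl -scalerA opprD addrACA -scalerBr.
      by case: sW => _; apply.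
    - by rewrite inE.
  (* No variable is left but lam is not empty: the generator 1 kills v. *)
  rewrite negb_forall => /existsP[b lb]; exists [::]; split=> // y.
  apply: cyc_min => //=.
  suff: W (esym_on (set0 : {set 'I_n}) 0 * v) by rewrite esym_on_0 mul1r.
  case: gW => _; apply; first exact: sub0set.
  by rewrite cards0 /excess (bigD1 b) //=; lia.
have cD : #|D| = #|D :\ a|.+1 by rewrite (cardsD1 a) aD.
(* Layer i of the filtration by the powers of X_a is matched with the row in
   position i of an ordering of the rows of lam by decreasing length. *)
pose r : rel 'I_s := fun b b' => (lam b' <= lam b)%N.
pose bs := sort r (enum 'I_s).
have bs_perm : perm_eq bs (index_enum 'I_s) by rewrite perm_sort enumT.
have bs_sorted : sorted r bs by apply: sort_sorted => b b'; exact: leq_total.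
have bs_size : size bs = s by rewrite size_sort size_enum_ord.
(* Downward induction on layers: pre holds the rows of the layers below the
   current one, and its size is the current power of X_a. *)
suff H suf pre : bs = pre ++ suf -> exists L : seq P,
    size L = (\sum_(b <- suf) nb_words #|D :\ a| (dec_at lam b))%N /\
    forall y, cyc D ('X_a ^+ size pre * v) y -> span_mod W L y.
  have [L [sL LP]] := H bs [::] erefl; exists L; split.
    by rewrite sL cD /=; exact: perm_big.
  by move=> y; rewrite -[X in cyc _ X](mul1r v); exact: LP.
elim: suf pre => [|b suf IHsuf] pre def_bs.
  exists [::]; rewrite big_nil; split=> // y; apply: cyc_min => //.
  (* Past the last layer the power X_a ^+ s is one of the generators. *)
  have -> : size pre = s by move: bs_size; rewrite def_bs cats0.
  by case: gW => + _; apply.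
have [|L2 [sL2 L2P]] := IHsuf (rcons pre b); first by rewrite cat_rcons.
rewrite size_rcons in L2P.
have Hb c : (lam b <= c)%N -> (\sum_(b' < s) (c < lam b')%N <= size pre)%N.
  move=> lbc; rewrite -(perm_big _ bs_perm) /= def_bs big_cat /=.
  rewrite [X in (_ + X)%N]big1_seq ?addn0.
    by rewrite -sum1_size; apply: leq_sum => b' _; case: (_ < _)%N.
  move=> b' /=; rewrite inE => b'suf; apply/eqP; rewrite eqb0 -leqNgt.
  apply: leq_trans lbc; case/orP: b'suf => [/eqP->//|b'suf].
  move: bs_sorted; rewrite def_bs => /(subseq_sorted _ (suffix_subseq _ _)).
  have r_tr : transitive r by move=> x y z; rewrite /r => yx /leq_trans; apply.
  move=> /(_ r_tr) /= /(order_path_min r_tr) /allP; exact.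
have lay := gens_in_layer sW WM gW aD Hb.
have [|||L1 [sL1 L1P]] := IHm _ _ _ _ _ _ _ lay.
- by rewrite -ltnS -cD.
- split.
    exists 0, 0; rewrite addr0; split=> //; first by case: sW.
    exact: cyc_0.
  move=> c x y [w1 [z1 [Ww1 Wz1 ->]]] [w2 [z2 [Ww2 Wz2 ->]]].
  exists (c *: w1 + w2), (c *: z1 + z2); rewrite scalerDr addrACA; split=> //.
    by case: sW => _; apply.
  exact: cyc_lin.
- move=> j y /setD1P[_ jD] [w [z [Ww Wz ->]]].
  exists ('X_j * w), ('X_j * z); rewrite mulrDr; split=> //.
    exact: WM.
  exact: cyc_X.
have sWL2 := span_mod_subsp L2 sW.
exists (L1 ++ L2); rewrite size_cat sL1 sL2 big_cons; split=> // y yP.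
have [y0 [y1 [y0P y1P ->]]] := cyc_split aD yP.
apply: span_mod_cat; apply: subspD; first exact: span_mod_subsp.
  apply: span_mod_mono (L1P _ y0P) => x [w [z [Ww zP ->]]].
  by apply: subspD => //; [exact: span_mod_sub|exact: L2P].
apply: span_mod_sub => //; apply: L2P.
by rewrite exprS -mulrA.
Qed.

End UpperBound.

(** * Ordered set partitions as words *)
Section Blocks.
Variables (n : nat) (la : seq nat) (s : nat).
Notation OP := (OP n la s).
Implicit Types (B : OP) (i : 'I_n) (b : 'I_s) (w : 'S_n).

Lemma osp_block_ex B i : exists b, i \in val B b.
Proof.
case: B => B /= /and3P[_ /eqP/setP/(_ i)]; rewrite inE.
by case/bigcupP => b _ iB; exists b.
Qed.

(** The index of the block of [B] that contains [i]. *)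
Definition osp_block B i : 'I_s := xchoose (osp_block_ex B i).

Lemma osp_blockE B i b : (i \in val B b) = (osp_block B i == b).
Proof.
have iB : i \in val B (osp_block B i) by exact: (xchooseP (osp_block_ex B i)).
apply/idP/eqP => [iBb|<- //]; apply/eqP; apply: contraTT iB => neq_b.
have /and3P[/'forall_'forall_implyP dB _ _] := valP B.
by rewrite (disjointFl (dB _ _ neq_b) iBb).
Qed.

Lemma osp_block_inj B C : osp_block B =1 osp_block C -> B = C.
Proof.
move=> BC; apply/val_inj/ffunP => b; apply/setP => i.
by rewrite !osp_blockE BC.
Qed.

Lemma osp_block_act w B i : osp_block (OP_act w B) (w i) = osp_block B i.
Proof.
apply/eqP; rewrite -osp_blockE ffunE mem_imset; last exact: perm_inj.
by rewrite osp_blockE.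
Qed.

Lemma card_osp B b : (nth 0%N la b <= #|val B b|)%N.
Proof. by case: B => B /= /and3P[_ _ /forallP]. Qed.

End Blocks.

Section Counting.
Variables (s : nat).
Implicit Types (lam : 'I_s -> nat).

(** The words of length [n] in which each letter [b] occurs at least [lam b]
    times. *)
Definition words n lam : {set n.-tuple 'I_s} :=
  [set t : n.-tuple 'I_s | [forall b, (lam b <= count_mem b t)%N]].

Lemma card_words n lam : #|words n lam| = nb_words n lam.
Proof.
elim: n lam => [|n IHn] lam.
  rewrite /= -sum1_card big_mkcond /= (big_pred1 [tuple]); last first.
    by move=> t; apply/esym/eqP; rewrite tuple0.
  rewrite inE.
  by under eq_forallb => b do rewrite leqn0.
rewrite /= -(eq_bigr _ (fun b _ => IHn (dec_at lam b))) -sum1_card big_mkcond /=.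
pose h (p : 'I_s * n.-tuple 'I_s) := [tuple of p.1 :: p.2].
rewrite (reindex h) /=; last first.
  exists (fun t : n.+1.-tuple 'I_s => (thead t, [tuple of behead t])).
    by case=> b t _; congr (_, _); apply: val_inj.
  by move=> t _; rewrite /h /= [RHS]tuple_eta.
rewrite -(pair_bigA _ (fun b t => if h (b, t) \in words n.+1 lam then 1%N else 0%N)) /=.
apply: eq_bigr => b _; rewrite -sum1_card [RHS]big_mkcond /=.
apply: eq_bigr => t _; rewrite !inE; congr (if _ then _ else _).
by apply: eq_forallb => b' /=; rewrite /dec_at (eq_sym b'); lia.
Qed.

(** A word with enough occurrences of each letter is the list of the block indices
    of an ordered set partition. The opposite inequality holds as well, but only
    this one is used. *)
Lemma leq_nb_words_OP n la :
  (nb_words n (fun b : 'I_s => nth 0%N la b) <= #|OP n la s|)%N.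
Proof.
rewrite -card_words.
pose f (B : OP n la s) := [tuple osp_block B i | i < n].
apply: leq_trans (leq_imset_card f predT).
apply/subset_leq_card/subsetP => t; rewrite inE => /forallP tP.
pose B0 := [ffun b : 'I_s => [set i : 'I_n | tnth t i == b]].
have B0P : is_osp la B0.
  apply/and3P; split.
  - apply/'forall_'forall_implyP => b b' neq_b; rewrite -setI_eq0; apply/eqP/setP.
    by move=> i; rewrite !ffunE !inE; apply/negbTE; apply: contra neq_b => /andP[/eqP<-].
  - apply/eqP/setP => i; rewrite inE; apply/bigcupP; exists (tnth t i) => //.
    by rewrite ffunE inE.
  apply/forallP => b; apply: leq_trans (tP b) _; rewrite ffunE.
  by rewrite -sum1_count big_tuple sum1dep_card.
apply/imsetP; exists (Sub B0 B0P) => //; apply: eq_from_tnth => i.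
by apply/esym/eqP; rewrite tnth_mktuple -osp_blockE SubK ffunE inE.
Qed.

End Counting.

(** * The statistic of the defining ideal as an excess *)
Section PStat.
Variables (n k s : nat) (la : seq nat).
Hypotheses (le_kn : (k <= n)%N) (la_part : is_partition k la).
Hypothesis size_la : (size la <= s)%N.
Let lam (b : 'I_s) := nth 0%N la b.

Lemma sum_parts (F : nat -> nat) : F 0%N = 0%N ->
  (\sum_(part <- la) F part = \sum_(b < s) F (lam b))%N.
Proof.
move=> F0; rewrite (big_nth 0%N) big_mkord.
rewrite (big_ord_widen _ (fun i => F (nth 0%N la i)) size_la).
rewrite big_mkcond /=; apply: eq_bigr => b _; case: ltnP => // ltb.
by rewrite /lam nth_default.
Qed.

Lemma sum_lam : (\sum_(b < s) lam b)%N = k.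
Proof.
rewrite -(sum_parts (F := id)) // -sumnE.
by case/and3P: la_part => _ _ /eqP.
Qed.

Lemma lam_le b : (lam b <= n)%N.
Proof. by apply: leq_trans le_kn; rewrite -sum_lam (bigD1 b) //= leq_addr. Qed.

Lemma p_statE m : (m <= n)%N -> p_stat n la m = excess lam (n - m).
Proof.
move=> le_mn; rewrite /p_stat /excess.
under eq_bigr => i _ do rewrite /conj_part -sum1_count big_mkcond /=.
rewrite exchange_big /= (sum_parts (F := fun part => \sum_(i < m) _)) /=; last first.
  rewrite big1 // => i _; rewrite leqn0 subn_eq0 leqNgt.
  by rewrite (leq_trans (ltn_ord i)).
apply: eq_bigr => b _; elim: m le_mn => [|m IHm] lt_mn.
  by rewrite big_ord0 subn0; have := lam_le b; lia.
rewrite big_ord_recr /= IHm; last exact: ltnW.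
by have := lam_le b; case: ifP; lia.
Qed.

(** In degree 0 the generators thus impose no condition, in agreement with the
    restriction to positive degrees in the defining ideal. *)
Lemma excess_le c : (c <= n)%N -> (excess lam c <= n - c)%N.
Proof.
move=> le_cn; have [/existsP[b ltb]|] := boolP [exists b, c < lam b]%N; last first.
  rewrite negb_exists => /forallP Hb; rewrite /excess big1 // => b _.
  by have := Hb b; lia.
have sum_k : (lam b + \sum_(i < s | i != b) lam i)%N = k.
  by rewrite -[RHS]sum_lam [RHS](bigD1 b).
rewrite /excess (bigD1 b) //=.
have : (\sum_(i < s | i != b) (lam i - c) <= \sum_(i < s | i != b) lam i)%N.
  by apply: leq_sum => i _; exact: leq_subr.
move: sum_k ltb le_kn; move: (lam b) (\sum_(i < s | _) _)%N.
by move: (\sum_(i < s | _) _)%N; lia.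
Qed.

End PStat.

(** * A small spanning set of the quotient ring *)
Section SpanQuotient.
Variables (n k s : nat) (la : seq nat).
Hypotheses (le_kn : (k <= n)%N) (la_part : is_partition k la).
Hypothesis size_la : (size la <= s)%N.

Lemma cyc_setT (p : {mpoly rat[n]}) : cyc [set: 'I_n] 1 p.
Proof.
have cycS := cyc_subsp [set: 'I_n] (1 : {mpoly rat[n]}).
rewrite [p]mpolyE; elim/big_ind: _ => [|x y|m _]; first exact: cyc_0.
  exact: subspD.
apply: subspZ => //; rewrite mpolyXE_id.
elim/big_rec: _ => [|i x _ xP]; first exact: cyc_gen.
elim: (m i) => [|e IHe]; first by rewrite expr0 mul1r.
by rewrite exprS -mulrA; apply: cyc_X => //; rewrite inE.
Qed.

Lemma R_quot_span : exists L : seq {mpoly rat[n]},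
  (size L <= #|OP n la s|)%N /\
  forall p, exists c : 'I_(size L) -> rat,
    p - \sum_(i < size L) c i *: L`_i \in gen_ideal (@I_gen n la s).
Proof.
set I := gen_ideal _.
have genI g : I_gen la s g -> g \in I.
  move=> Ig; apply/gen_idealP; exists 1%N, (fun=> 1), (fun=> g).
  by rewrite big_ord1 mul1r.
have sI : subsp (fun p => p \in I).
  split=> [|c x y Ix Iy]; first exact: rpred0.
  by apply: rpredD => //; rewrite -mul_mpolyC; exact: gen_idealM.
have mI : mul_closed [set: 'I_n] (fun p => p \in I).
  by move=> i y _; exact: gen_idealM.
have gI : gens_in [set: 'I_n] (fun b : 'I_s => nth 0%N la b) 1 (fun p => p \in I).
  split=> [i _|S d _]; rewrite mulr1; first by apply/genI; left.
  rewrite cardsT card_ord => ltS; apply: genI.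
  have leS : (#|S| <= n)%N by rewrite -[X in (_ <= X)%N]card_ord max_card.
  have := excess_le le_kn la_part size_la (leq_subr #|S| n).
  case: d ltS => [|d] ltS ltE; first by lia.
  by right; rewrite // (p_statE le_kn la_part size_la).
have [L [sL LP]] := span_cyc sI mI gI; exists L; split.
  by rewrite sL cardsT card_ord leq_nb_words_OP.
by move=> p; have /span_mod_sum := LP p (cyc_setT p).
Qed.

End SpanQuotient.

(** * The generators are top forms of polynomials vanishing on a set of points *)
Section Degrees.
Variables (n : nat).
Implicit Types (p : {mpoly rat[n]}) (d : nat).

(** Recall that [msize p] is one more than the degree of a nonzero [p]; hence
    [msize p <= d] says that [p] has degree less than [d]. *)
Lemma msize_sum_le d (I : Type) (r : seq I) (F : I -> {mpoly rat[n]}) :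
  (forall i, (msize (F i) <= d)%N) -> (msize (\sum_(i <- r) F i) <= d)%N.
Proof.
move=> Fd; apply: leq_trans (mmeasure_sum _ _ _ _) _.
by elim/big_ind: _ => // x y xd yd; rewrite geq_max xd.
Qed.

Lemma msize_dhomog d p : p \is d.-homog -> (msize p <= d.+1)%N.
Proof.
move/dhomogP => pd; rewrite msizeE; apply/bigmax_leqP_seq => m mp _.
by rewrite (pd _ mp).
Qed.

Lemma esym_on_homog (S : {set 'I_n}) d : esym_on S d \is d.-homog.
Proof.
rewrite /esym_on; apply: rpred_sum => T /andP[_ /eqP <-].
rewrite -sum1_card; elim/big_rec2: _ => [|i k p _ pk]; first exact: dhomog1.
by apply: dhomogM => //; rewrite dhomogX /= mdeg1.
Qed.

Lemma Xn_homog (i : 'I_n) d : ('X_i ^+ d : {mpoly rat[n]}) \is d.-homog.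
Proof.
by rewrite -[X in X.-homog]mul1n; apply: dhomogMn; rewrite dhomogX /= mdeg1.
Qed.

End Degrees.

Section TruncatedInverse.
Variable K : fieldType.

Lemma poly_inv_mod (G : {poly K}) (N : nat) : G`_0 = 1 ->
  exists C Q : {poly K}, C * G = 1 + Q * 'X^N.
Proof.
move=> G0; have /factor_theorem[Q defQ] : root (1 - G) 0.
  by rewrite /root hornerD hornerN hornerC horner_coef0 G0 subrr.
rewrite subr0 in defQ.
exists (\sum_(i < N) (1 - G) ^+ i), (- Q ^+ N).
have := subrX1 (1 - G) N; rewrite {1}defQ exprMn => /eqP.
rewrite subr_eq => /eqP def; rewrite mulNr def; ring.
Qed.

Lemma size_prod_linear (I : Type) (r : seq I) (a : I -> K) (k : I -> nat) :
  (size (\prod_(i <- r) (1 - (a i)%:P * 'X) ^+ k i)%R <= (\sum_(i <- r) k i).+1)%N.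
Proof.
elim: r => [|i r IHr]; first by rewrite !big_nil size_poly1.
rewrite !big_cons; move: (\prod_(_ <- r) _) (\sum_(_ <- r) _)%N IHr => p m pm.
apply: leq_trans (size_polyMleq _ _) _.
set q : {poly K} := 1 - _.
have sq : (size q <= 2)%N.
  apply: leq_trans (size_polyD _ _) _; rewrite size_poly1 size_polyN geq_max /=.
  by apply: leq_trans (size_polyMleq _ _) _; rewrite size_polyX size_polyC; case: eqP.
have : (size (q ^+ k i) <= (k i).+1)%N.
  by apply: leq_trans (size_poly_exp_leq _ _) _; move: (size q) sq => x; nia.
by move/leq_add=> /(_ _ _ pm); rewrite addSn addnS -subn1 leq_subLR add1n.
Qed.

End TruncatedInverse.

Section Vanishing.
Variables (n s : nat).
Implicit Types (S : {set 'I_n}) (a : 'I_n -> rat).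

(** The generating function of the values of the [e_d(S)] at a point. *)
Lemma prod_linear_esym S a d :
  (\prod_(i in S) (1 - (a i)%:P * 'X))`_d = (-1) ^+ d * (esym_on S d).@[a].
Proof.
have [m] := ubnP #|S|; elim: m => // m IHm in S d *.
have [->|[x xS] ltm] := set_0Vmem S.
  rewrite big_set0 coef1; case: d => [|d] _.
    by rewrite esym_on_0 meval1 mulr1.
  by rewrite esym_on_set0 meval0 mulr0.
have xSx : x \notin S :\ x by rewrite !inE eqxx.
have ltSx : (#|S :\ x| < m)%N by move: ltm; rewrite (cardsD1 x) xS.
rewrite -(setD1K xS) big_setU1 //= mulrBl mul1r coefB -mulrA coefCM coefXM.
case: d => [|d] /=; first by rewrite mulr0 subr0 IHm // !esym_on_0.
rewrite !IHm // esym_on_setU1 // rmorphD rmorphM /= mevalXU exprS; ring.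
Qed.

(** Let [alpha \o f] be a point at which each value [alpha b] is taken at least
    [mu b] times on [S]. Then the product of the [1 - a_i X], for [i] in [S], is
    divisible by the product [G] of the [(1 - alpha_b X) ^ mu_b], with a quotient
    of degree at most [#|S|] minus the sum of the [mu b]. Dividing by [G] as power
    series, the coefficients of higher degree vanish; this is a linear relation
    between the values of [e_d(S), e_(d-1)(S), ...] that depends on [G] only.
    The polynomial [C] is an inverse of [G] modulo [X^(d+1)]. *)
Lemma esym_relation S d (f : 'I_n -> 'I_s) (alpha : 'I_s -> rat) (mu : 'I_s -> nat)
    (C Q : {poly rat}) :
  C * (\prod_(b < s) (1 - (alpha b)%:P * 'X) ^+ mu b) = 1 + Q * 'X^(d.+1) ->
  (forall b, mu b <= #|[set i in S | f i == b]|)%N ->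
  (#|S| < d + \sum_(b < s) mu b)%N ->
  \sum_(j < d.+1) C`_j * ((-1) ^+ (d - j) * (esym_on S (d - j)).@[alpha \o f]) = 0.
Proof.
set G := \prod_(b < s) _ => CG le_mu ltS.
pose nu b := #|[set i in S | f i == b]|.
pose H := \prod_(b < s) (1 - (alpha b)%:P * 'X) ^+ (nu b - mu b).
have sum_nu : (\sum_(b < s) nu b = #|S|)%N.
  rewrite -sum1_card (partition_big f predT) //=.
  by apply: eq_bigr => b _; rewrite sum1dep_card.
have E_def : \prod_(i in S) (1 - ((alpha \o f) i)%:P * 'X) = G * H.
  rewrite (partition_big f predT) //= -big_split; apply: eq_bigr => b _ /=.
  rewrite -exprD subnKC // -prodr_const.
  by apply: eq_big => [i|i /andP[_ /eqP->]//]; rewrite inE.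
have H_small : (size H <= d)%N.
  apply: leq_trans (size_prod_linear _ _ _) _.
  suff : (\sum_(b < s) (nu b - mu b) + \sum_(b < s) mu b = #|S|)%N.
    move: ltS; move: (\sum_(b < s) mu b)%N (\sum_(b < s) (nu b - mu b))%N; lia.
  rewrite -sum_nu -big_split; apply: eq_bigr => b _ /=; exact: subnK.
transitivity (C * (G * H))`_d.
  rewrite coefM; apply: eq_bigr => j _; rewrite -E_def prod_linear_esym //.
rewrite mulrA CG mulrDl mul1r mulrAC coefD coefMXn ltnSn addr0.
by rewrite nth_default.
Qed.

End Vanishing.

(** * Evaluation at the points of ordered set partitions *)
Section Points.
Variables (n : nat) (la : seq nat) (s : nat).
Notation OP := (OP n la s).
Notation P := {mpoly rat[n]}.
Implicit Types (B : OP) (p : P) (w : 'S_n) (S : {set 'I_n}).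
Notation lam := (fun b : 'I_s => nth 0%N la b).

(** The point attached to [B], whose [i]-th coordinate is the index of the block
    that contains [i]. Any [s] distinct rational numbers could replace the
    indices. *)
Definition osp_pt B (i : 'I_n) : rat := (osp_block B i : nat)%:R.

Lemma osp_pt_act w B i : osp_pt (OP_act w^-1 B) i = osp_pt B (w i).
Proof.
by rewrite /osp_pt -[in RHS](osp_block_act w^-1) permK.
Qed.

Lemma osp_pt_inj B C : osp_pt B =1 osp_pt C -> B = C.
Proof.
move=> BC; apply: osp_block_inj => i; apply: val_inj; apply/eqP.
by rewrite -(eqr_nat rat); apply/eqP/BC.
Qed.

(** On the points, each generator [e_d(S)] of the ideal agrees with a polynomial of
    degree less than [d]. *)
Lemma esym_lower S d : (#|S| < d + excess lam (n - #|S|))%N ->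
  exists2 g : P, (msize g <= d)%N &
    forall B, (esym_on S d).@[osp_pt B] = g.@[osp_pt B].
Proof.
(* Outside S there are n - #|S| letters only, so that block b has at least mu b
   elements in S. *)
move=> ltS; pose mu (b : 'I_s) := (nth 0%N la b - (n - #|S|))%N.
pose alpha (b : 'I_s) : rat := (b : nat)%:R.
pose G := \prod_(b < s) (1 - (alpha b)%:P * 'X) ^+ mu b : {poly rat}.
have G0 : G`_0 = 1.
  rewrite -horner_coef0 horner_prod big1 // => b _.
  by rewrite horner_exp hornerD hornerN hornerM hornerX mulr0 !hornerC subr0 expr1n.
have [C [Q CG]] := poly_inv_mod d.+1 G0.
have C0 : C`_0 = 1.
  have := congr1 (fun p : {poly rat} => p`_0) CG.
  by rewrite coef0M G0 mulr1 coefD coef1 coefMXn addr0.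
exists (- (-1) ^+ d *: \sum_(j < d)
    (C`_j.+1 * (-1) ^+ (d - j.+1)) *: esym_on S (d - j.+1)).
  apply: leq_trans (mmeasureZ_le _ _ _) _; apply: msize_sum_le => j.
  apply: leq_trans (mmeasureZ_le _ _ _) _.
  by apply: leq_trans (msize_dhomog (esym_on_homog _ _)) _; have := ltn_ord j; lia.
move=> B.
have := @esym_relation n s S d (osp_block B) alpha mu C Q CG _ ltS.
rewrite big_ord_recl subn0 C0 mul1r => rel.
rewrite mevalZ; apply: (mulrI (x := (-1) ^+ d)).
  by rewrite unitfE signr_eq0.
rewrite mulrA mulrN -signr_odd -signr_addb addbb expr0 mulN1r.
apply/eqP; rewrite -addr_eq0 signr_odd; apply/eqP; rewrite -[RHS]rel; last first.
  move=> b; rewrite leq_subLR; apply: leq_trans (card_osp B b) _.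
  have -> : (n - #|S|)%N = #|~: S| by rewrite [RHS]cardsCs setCK card_ord.
  rewrite -(cardsID S) addnC; apply: leq_add.
    by rewrite setDE; apply: subset_leq_card; exact: subsetIr.
  apply: subset_leq_card; apply/subsetP => i; rewrite !inE osp_blockE.
  by rewrite andbC.
congr (_ + _); rewrite raddf_sum; apply: eq_bigr => j _.
by rewrite /= mevalZ mulrA.
Qed.

Lemma pow_lower i : exists2 g : P, (msize g <= s)%N &
  forall B, ('X_i ^+ s : P).@[osp_pt B] = g.@[osp_pt B].
Proof.
pose q := \prod_(b < s) ('X - ((b : nat)%:R : rat)%:P).
have sq : size q = s.+1.
  by rewrite size_prod_XsubC -sum1_size sum_nat_const card_ord muln1.
exists (- \sum_(j < s) q`_j *: 'X_i ^+ j).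
  rewrite mmeasureN; apply: msize_sum_le => j.
  apply: leq_trans (mmeasureZ_le _ _ _) _.
  exact: leq_trans (msize_dhomog (Xn_homog i j)) (ltn_ord j).
move=> B; rewrite rmorphXn /= mevalXU mevalN.
have : q.[osp_pt B i] = 0.
  by rewrite horner_prod (bigD1 (osp_block B i)) //= !hornerE subrr mul0r.
rewrite horner_coef sq big_ord_recr /=.
have -> : q`_s = 1.
  have := monic_prod_XsubC (index_enum 'I_s) xpredT (fun b : 'I_s => (b : nat)%:R : rat).
  by move=> /monicP; rewrite lead_coefE -/q sq.
rewrite mul1r => /eqP; rewrite addrC addr_eq0 => /eqP ->; congr (- _).
rewrite raddf_sum; apply: eq_bigr => j _.
by rewrite /= mevalZ rmorphXn /= mevalXU.
Qed.

(** The restriction of a polynomial to the points. *)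
Definition ev p : {ffun OP -> rat^o} := [ffun B => (p.@[osp_pt B] : rat^o)].

Lemma ev_linear : linear ev.
Proof. by move=> c p q; apply/ffunP => B; rewrite !ffunE mevalD mevalZ. Qed.

HB.instance Definition _ :=
  GRing.isLinear.Build rat P {ffun OP -> rat^o} *:%R ev ev_linear.

Lemma ev_msym w p : ev (msym w p) = QOP_act w (ev p).
Proof.
apply/ffunP => B; rewrite !ffunE.
rewrite [p]mpolyE; elim/big_rec: _ => [|m q _ IHq]; first by rewrite msym0 !meval0.
rewrite msymD msymZ !mevalD !mevalZ IHq mpolyXE_id !rmorph_prod /=.
congr (_ * _ + _); apply: eq_bigr => i _.
by rewrite !rmorphXn /= msymXU !mevalXU osp_pt_act.
Qed.

Lemma ev_surj (f : {ffun OP -> rat^o}) : exists p, ev p = f.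
Proof.
pose sep B C : P := if [pick i | osp_pt B i != osp_pt C i] is Some i
  then (osp_pt B i - osp_pt C i)^-1 *: ('X_i - (osp_pt C i)%:MP) else 0.
have sepl B C : B != C -> (sep B C).@[osp_pt B] = 1.
  rewrite /sep; case: pickP => [i neq_i _|eqBC].
    by rewrite mevalZ mevalB mevalXU mevalC mulVf // subr_eq0.
  by case/eqP; apply: osp_pt_inj => i; apply/eqP; rewrite -[_ == _]negbK eqBC.
have sepr B C : (sep B C).@[osp_pt C] = 0.
  rewrite /sep; case: pickP => [i _|_]; last by rewrite meval0.
  by rewrite mevalZ mevalB mevalXU mevalC subrr mulr0.
exists (\sum_B f B *: \prod_(C | C != B) sep B C); apply/ffunP => B.
rewrite ffunE raddf_sum /= (bigD1 B) //= [X in _ + X]big1 => [|C neqCB].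
  rewrite addr0 mevalZ rmorph_prod /= big1 ?mulr1 // => C neqCB.
  by rewrite sepl // eq_sym.
by rewrite mevalZ rmorph_prod /= (bigD1 B) 1?eq_sym //= sepr mul0r mulr0.
Qed.

End Points.

(** * Equivariant projections *)

(** Maschke's theorem for a subspace [U] that is stable under a finite group. The
    action is on the right, as for permutations in [QOP_act]. *)
Section Averaging.
Variables (gT : finGroupType) (V : vectType rat) (act : gT -> {linear V -> V}).
Hypothesis actM : forall g h v, act (g * h)%g v = act h (act g v).
Hypothesis act1 : forall v, act 1%g v = v.
Variable U : {vspace V}.
Hypothesis actU : forall g v, v \in U -> act g v \in U.

(** The average over the group of the conjugates of a projection onto [U]. *)
Definition avg_proj (v : V) : V :=
  #|gT|%:R^-1 *: \sum_g act g^-1%g (projv U (act g v)).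

Lemma avg_proj_linear : linear avg_proj.
Proof.
move=> c u v; rewrite /avg_proj scalerA mulrC -scalerA -scalerDr; congr (_ *: _).
by rewrite scaler_sumr -big_split; apply: eq_bigr => g _; rewrite !linearP.
Qed.

HB.instance Definition _ :=
  GRing.isLinear.Build rat V V *:%R avg_proj avg_proj_linear.

Lemma avg_proj_in v : avg_proj v \in U.
Proof.
by apply: memvZ; apply: memv_suml => g _; apply: actU; exact: memv_proj.
Qed.

Lemma avg_proj_id v : v \in U -> avg_proj v = v.
Proof.
move=> Uv; rewrite /avg_proj (eq_bigr (fun=> v)) => [|g _]; last first.
  by rewrite projv_id ?actU // -actM mulgV act1.
rewrite sumr_const -scaler_nat scalerA mulVf ?scale1r //.
by rewrite pnatr_eq0 -lt0n; apply/card_gt0P; exists 1%g.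
Qed.

Lemma avg_proj_act h v : avg_proj (act h v) = act h (avg_proj v).
Proof.
rewrite /avg_proj [RHS]linearZ /=; congr (_ *: _); rewrite raddf_sum.
rewrite [RHS](reindex_inj (mulgI h)) /=; apply: eq_bigr => g _.
by rewrite -[RHS]actM invMg mulgKV actM.
Qed.

End Averaging.

(** * The top-degree evaluation map *)
Section Harmonics.
Variables (n : nat) (la : seq nat) (s : nat).
Notation OP := (OP n la s).
Notation P := {mpoly rat[n]}.
Notation V := {ffun OP -> rat^o}.
Notation lam := (fun b : 'I_s => nth 0%N la b).
Notation ev := (@ev n la s).
Implicit Types (p : P) (d : nat) (v : V) (w : 'S_n).

(** The action of permutations on [QOP], seen as functions of ordered set
    partitions; this form carries the structure of a vector space of finite
    dimension. *)
Definition osp_act w (v : V) : V := QOP_act w v.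

HB.instance Definition _ w :=
  GRing.isLinear.Build rat V V *:%R (osp_act w) (@QOP_act_linear n la s w).

Lemma osp_act1 v : osp_act 1 v = v.
Proof. by apply/ffunP => B; rewrite ffunE invg1 OP_act1. Qed.

Lemma osp_actM g h v : osp_act (g * h)%g v = osp_act h (osp_act g v).
Proof. by apply/ffunP => B; rewrite !ffunE invMg OP_actM. Qed.

(** The restrictions to the points of the polynomials of degree less than [d]. *)
Definition lowspace d : {vspace V} :=
  <<[tuple of codom (fun m : 'X_{1..n < d} => ev 'X_[bmnm m])]>>%VS.

Lemma ev_lowspace d p : (msize p <= d)%N -> ev p \in lowspace d.
Proof.
move=> pd; rewrite [p]mpolyE linear_sum big_seq; apply: memv_suml => m mp.
have ltm : (mdeg m < d)%N by apply: leq_trans pd; exact: msize_mdeg_lt.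
rewrite linearZ; apply/memvZ/memv_span; apply/codomP.
by exists (BMultinom ltm).
Qed.

Lemma lowspaceP d v : v \in lowspace d -> exists2 p, (msize p <= d)%N & ev p = v.
Proof.
move=> /coord_span vE; rewrite vE; set X := [tuple of _].
exists (\sum_i coord X i v *: 'X_[bmnm (enum_val i)]).
  apply: msize_sum_le => i; apply: leq_trans (mmeasureZ_le _ _ _) _.
  by rewrite mmeasureX bmdeg.
rewrite linear_sum; apply: eq_bigr => i _; rewrite linearZ; congr (_ *: _).
by rewrite -tnth_nth tnth_map (tnth_nth (enum_val i)) /= -enum_val_nth.
Qed.

Lemma lowspace_act d w v : v \in lowspace d -> osp_act w v \in lowspace d.
Proof.
case/lowspaceP => p pd <-; rewrite /osp_act -ev_msym; apply: ev_lowspace.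
rewrite msizeE; apply/bigmax_leqP_seq => m mp _.
apply: leq_trans pd; rewrite mcoeff_msupp mcoeff_sym -mcoeff_msupp in mp.
by have := msize_mdeg_lt mp; rewrite mdeg_mperm.
Qed.

Lemma lowspace_full : exists D, lowspace D = fullv.
Proof.
pose X := vbasis (fullv : {vspace V}).
have /fin_all_exists[q qP] (i : 'I_(\dim (fullv : {vspace V}))) :
  exists p, ev p = X`_i by exact: ev_surj.
exists (\max_i msize (q i)); apply/vspaceP => v; rewrite memvf.
rewrite (coord_basis (vbasisP _) (memvf v)); apply: memv_suml => i _; apply: memvZ.
by rewrite -qP; apply: ev_lowspace; exact: leq_bigmax.
Qed.

(** An equivariant projection onto [lowspace d]. *)
Definition low_proj d v : V := avg_proj osp_act (lowspace d) v.

HB.instance Definition _ d := GRing.Linear.copy (low_proj d)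
  (avg_proj osp_act (lowspace d)).

(** The restriction of [p] to the points, where the component of degree [d] counts
    only through its class modulo [lowspace d], as represented in the chosen
    equivariant complement of [lowspace d]. This identifies the graded space of
    the filtration of [QOP] by the [lowspace d] with [QOP] itself, without breaking
    the symmetry. Components of degree at least [D] are dropped, which loses
    nothing once [lowspace D] is everything. *)
Definition top_ev D p : V :=
  \sum_(d < D) (ev (pihomog mdeg d p) - low_proj d (ev (pihomog mdeg d p))).

Lemma top_ev_linear D : linear (top_ev D).
Proof.
move=> c p q; rewrite /top_ev scaler_sumr -big_split; apply: eq_bigr => d _ /=.
by rewrite !linearP addrACA -scalerDr.
Qed.

HB.instance Definition _ D :=
  GRing.isLinear.Build rat P V *:%R (top_ev D) (top_ev_linear D).

Lemma top_ev_msym D w p : top_ev D (msym w p) = osp_act w (top_ev D p).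
Proof.
rewrite /top_ev [RHS]linear_sum; apply: eq_bigr => d _; rewrite [RHS]linearB /=.
rewrite -msym_pihomog ev_msym; congr (_ - _).
by apply: avg_proj_act; exact: osp_actM.
Qed.

Lemma top_ev_homog D e p : p \is e.-homog -> ev p \in lowspace e ->
  top_ev D p = 0.
Proof.
move=> pe lowp; rewrite /top_ev big1 // => d _.
have [de|de] := eqVneq (d : nat) e; last first.
  by rewrite (pihomog_ne0 _ pe) 1?eq_sym // !linear0 addr0.
rewrite de pihomog_dE // /low_proj avg_proj_id ?subrr //.
- exact: osp_actM.
- exact: osp_act1.
- exact: lowspace_act.
Qed.

(** Top forms of vanishing polynomials generate an ideal on which [top_ev]
    vanishes. *)
Lemma top_ev_mul_lower D e p (g : P) : g \is e.-homog ->
  (exists2 h : P, (msize h <= e)%N & forall B : OP, g.@[osp_pt B] = h.@[osp_pt B]) ->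
  top_ev D (p * g) = 0.
Proof.
move=> ge [h he gh]; rewrite [p]mpolyE mulr_suml linear_sum big1 // => m _.
rewrite -scalerAl linearZ /= (@top_ev_homog D (mdeg m + e)) ?scaler0 //.
  by apply: dhomogM => //; rewrite dhomogX.
have -> : ev ('X_[m] * g) = ev ('X_[m] * h).
  by apply/ffunP => B; rewrite !ffunE !mevalM gh.
apply: ev_lowspace; have [->|h0] := eqVneq h 0; first by rewrite mulr0 msize0.
rewrite msizeM //; first by rewrite msizeX addSn leq_add2l.
by rewrite -(mmeasure_poly_eq0 mdeg) msizeX.
Qed.

(** By induction on [d], every element of [lowspace d] is a value of [top_ev D]:
    it is the restriction of some [p] of degree at most [d - 1], and it differs
    from the value at the component of that degree by an element of
    [lowspace (d - 1)]. *)
Lemma top_ev_surj D v : lowspace D = fullv -> exists p, top_ev D p = v.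
Proof.
move=> lowD; suff H d : (d <= D)%N -> v \in lowspace d -> exists p, top_ev D p = v.
  by apply: (H D) => //; rewrite lowD memvf.
elim: d v => [|d IHd] v ltdD vlow.
  exists 0; rewrite linear0; apply/esym/eqP; move: vlow.
  by case/lowspaceP => p; rewrite leqn0 mmeasure_poly_eq0 => /eqP-> <-; rewrite linear0.
case/lowspaceP: vlow => p pd <-.
pose q := pihomog mdeg d p.
have qd : q \is d.-homog by exact: pihomogP.
have top_q : top_ev D q = ev q - low_proj d (ev q).
  rewrite /top_ev (bigD1 (Ordinal ltdD)) //= pihomog_dE // big1 ?addr0 // => j neq_j.
  by rewrite (pihomog_ne0 _ qd) 1?eq_sym // !linear0 addr0.
have [|r top_r] := IHd (ev (p - q) + low_proj d (ev q)) (ltnW ltdD).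
  apply: rpredD; last by apply: avg_proj_in; exact: lowspace_act.
  apply: ev_lowspace; rewrite {1}(pihomog_partitionE pd) big_ord_recr /=.
  rewrite addrK; apply: msize_sum_le => j; apply: leq_trans (ltn_ord j).
  by apply: msize_dhomog; exact: pihomogP.
by exists (q + r); rewrite linearD /= top_r top_q linearB /= addrCA !subrK.
Qed.

End Harmonics.

(** * Conclusion *)

(** A surjective linear map from a space spanned by [N] elements onto a space of
    dimension at least [N] is an isomorphism. *)
Lemma linear_surj_bij (K : fieldType) (W : lmodType K) (V : vectType K)
    (f : {linear W -> V}) (N : nat) (b : 'I_N -> W) :
    (forall x, exists c : 'I_N -> K, x = \sum_i c i *: b i) ->
    (forall v, exists x, f x = v) -> (N <= \dim (fullv : {vspace V}))%N ->
  bijective f /\ has_dim W (\dim (fullv : {vspace V})).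
Proof.
move=> b_span f_surj leN.
pose X := [tuple f (b i) | i < N].
have X_nth (i : 'I_N) : X`_i = f (b i) by rewrite -tnth_nth tnth_mktuple.
have f_sum (c : 'I_N -> K) : f (\sum_i c i *: b i) = \sum_i c i *: X`_i.
  by rewrite linear_sum; apply: eq_bigr => i _; rewrite linearZ X_nth.
have X_basis : basis_of fullv X.
  rewrite basisEdim size_tuple leN andbT; apply/subvP => v _.
  have [x <-] := f_surj v; have [c ->] := b_span x; rewrite f_sum.
  by apply: memv_suml => i _; apply/memvZ/memv_span/mem_nth; rewrite size_tuple.
have X_free := basis_free X_basis.
split.
  exists (fun v => \sum_i coord X i v *: b i) => [x|v].
    have [c ->] := b_span x; apply: eq_bigr => i _; congr (_ *: _).
    by rewrite f_sum coord_sum_free.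
  by rewrite f_sum -(coord_basis X_basis (memvf v)).
rewrite (vector.size_basis X_basis); exists b; split=> // c c0.
by have /freeP := X_free; apply; rewrite -f_sum c0 linear0.
Qed.

Theorem theorem3p21 (n k s : nat) (la : seq nat) :
  (0 < k)%N -> (k <= n)%N -> (0 < s)%N ->
  is_partition k la -> (size la <= s)%N ->
  has_dim (R_quot n la s) #|OP n la s| /\
  exists f : {linear R_quot n la s -> QOP n la s},
    bijective f /\
    forall (w : 'S_n) (x : R_quot n la s), f (R_act w x) = QOP_act w (f x).
Proof.
move=> _ le_kn _ la_part size_la.
have [D lowD] := lowspace_full n la s.
have top_ideal p : p \in gen_ideal (@I_gen n la s) -> @top_ev n la s D p = 0.
  case/gen_idealP => m [c [g [Gg ->]]]; rewrite linear_sum big1 // => i _.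
  case: (Gg i) => [j|S d d_gt0 ltS].
    by apply: (@top_ev_mul_lower _ _ _ D s); [exact: Xn_homog|exact: pow_lower].
  apply: (@top_ev_mul_lower _ _ _ D d); first exact: esym_on_homog.
  apply: esym_lower; rewrite -(p_statE le_kn la_part size_la) //.
  by rewrite -[X in (_ <= X)%N]card_ord max_card.
pose f (x : R_quot n la s) : QOP n la s :=
  @top_ev n la s D (generic_quotient.repr (x : quot_mod (@I_gen n la s))).
have f_proj p : f (quot_proj _ p) = @top_ev n la s D p.
  apply/eqP; rewrite -subr_eq0 -linearB; apply/eqP/top_ideal/quot_projP.
  by rewrite quot_projK.
have f_lin : linear f.
  move=> c x y; rewrite -(quot_projK x) -(quot_projK y).
  rewrite -[c *: _]quot_projZ -[_ + _]quot_projD !f_proj.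
  exact: linearP.
pose fL : {linear R_quot n la s -> QOP n la s} :=
  HB.pack f (GRing.isLinear.Build rat (R_quot n la s) (QOP n la s) *:%R f f_lin).
have [L [sL spanL]] := R_quot_span le_kn la_part size_la.
pose N := size L.
pose b (i : 'I_N) : R_quot n la s := quot_proj _ L`_i.
have b_span (x : R_quot n la s) : exists c : 'I_N -> rat, x = \sum_i c i *: b i.
  have [c Ic] := spanL (generic_quotient.repr (x : quot_mod (@I_gen n la s))).
  exists c; rewrite -[LHS]quot_projK; move/quot_projP: Ic => ->.
  elim/big_rec2: _ => [|i y1 y2 _ <-].
    by rewrite -[X in quot_proj _ X](scale0r 0) quot_projZ; exact: scale0r.
  by rewrite quot_projD quot_projZ.
have dimV : \dim (fullv : {vspace {ffun OP n la s -> rat^o}}) = #|OP n la s|.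
  by rewrite dimvf /dim /= muln1.
have f_surj v : exists x, fL x = v.
  by have [p <-] := top_ev_surj v lowD; exists (quot_proj _ p); exact: f_proj.
rewrite -dimV in sL.
have [f_bij R_dim] :=
  @linear_surj_bij _ _ {ffun OP n la s -> rat^o} fL _ b b_span f_surj sL.
split; first by rewrite -dimV.
exists fL; split=> // w x; rewrite /= -(quot_projK x) R_act_proj !f_proj.
exact: top_ev_msym.
Qed.
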